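(* For $b\in\mathbb C$ let $$B(b)=\begin{pmatrix}1&b&b&b\\0&b&1+b&0\\0&1+b&b&0\\0&0&0&1\end{pmatrix}$$ and, for chain length $L=2$, let $\tau_B(b)=\operatorname{tr}_a\big(B_{a2}(b)B_{a1}(b)\big)$ acting on $\mathbb C^2\otimes\mathbb C^2$. Then for all $p,q\in\mathbb C$ $$[\tau_B(p),\tau_B(q)]=4pq(p-q)\,\Omega,\qquad \Omega=Z_1\sigma_2^++\sigma_1^+Z_2-\sigma_1^+\sigma_2^+ .$$ In particular, $\tau_B(p)$ and $\tau_B(q)$ do not commute for generic $p,q$.
   Context: Matrices on $\mathbb C^2\otimes\mathbb C^2$ are written in the ordered basis $|00\rangle,|01\rangle,|10\rangle,|11\rangle$. $B_{aj}$ denotes $B$ acting on the auxiliary copy $a$ of $\mathbb C^2$ (first tensor factor) and the $j$-th physical copy of $\mathbb C^2$ (second tensor factor), and as the identity on the other factor; $\operatorname{tr}_a$ is the partial trace over the auxiliary copy. $Z=\begin{pmatrix}1&0\\0&-1\end{pmatrix}$, $\sigma^+=\begin{pmatrix}0&1\\0&0\end{pmatrix}$, and the subscripts $1,2$ indicate the tensor factor on which the operator acts. $[\cdot,\cdot]$ is the commutator. *)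

(* Defs.v *)
From HB Require Import structures.
From mathcomp Require Import all_boot all_order all_algebra.
From mathcomp Require Import reals.
From mathcomp Require Export complex mxtens.

Set Implicit Arguments.
Unset Strict Implicit.
Unset Printing Implicit Defensive.

Import GRing.Theory.
Local Open Scope ring_scope.

(* Operators on C^2 (x) C^2 are matrices of size 2 * 2; the row-major indexing
   mxtens_index (i, j) = 2 i + j is the ordered basis |00>, |01>, |10>, |11>. *)
Section Operators.
Variable C : nzRingType.

Definition mx_of_rows m n (rows : seq (seq C)) : 'M[C]_(m, n) :=
  \matrix_(i, j) (nth [::] rows i)`_j.

Definition Zmx : 'M[C]_2 :=
  mx_of_rows 2 2 [:: [:: 1; 0];
                     [:: 0; -1]].

Definition sigma_plus : 'M[C]_2 :=
  mx_of_rows 2 2 [:: [:: 0; 1];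
                     [:: 0; 0]].

Definition on1 (A : 'M[C]_2) : 'M[C]_(2 * 2) := A *t (1%:M : 'M[C]_2).
Definition on2 (A : 'M[C]_2) : 'M[C]_(2 * 2) := (1%:M : 'M[C]_2) *t A.

Definition commutator n (A B : 'M[C]_n) : 'M[C]_n := A *m B - B *m A.

Definition ptrace1 m n (A : 'M[C]_(m * n)) : 'M[C]_n :=
  \matrix_(i, j) \sum_(a < m) A (mxtens_index (a, i)) (mxtens_index (a, j)).

(* Row-major labels in the grouping C^2_a (x) (C^2_1 (x) C^2_2). *)
Definition aux (x : 'I_(2 * (2 * 2))) : 'I_2 := (mxtens_unindex x).1.
Definition phys1 (x : 'I_(2 * (2 * 2))) : 'I_2 :=
  (mxtens_unindex (mxtens_unindex x).2).1.
Definition phys2 (x : 'I_(2 * (2 * 2))) : 'I_2 :=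
  (mxtens_unindex (mxtens_unindex x).2).2.

Definition on_a1 (B : 'M[C]_(2 * 2)) : 'M[C]_(2 * (2 * 2)) :=
  \matrix_(x, y) (B (mxtens_index (aux x, phys1 x))
                    (mxtens_index (aux y, phys1 y))
                  * (phys2 x == phys2 y)%:R).

Definition on_a2 (B : 'M[C]_(2 * 2)) : 'M[C]_(2 * (2 * 2)) :=
  \matrix_(x, y) (B (mxtens_index (aux x, phys2 x))
                    (mxtens_index (aux y, phys2 y))
                  * (phys1 x == phys1 y)%:R).

Definition Bmx (b : C) : 'M[C]_(2 * 2) :=
  mx_of_rows (2 * 2) (2 * 2)
    [:: [:: 1; b;     b;     b];
        [:: 0; b;     1 + b; 0];
        [:: 0; 1 + b; b;     0];
        [:: 0; 0;     0;     1]].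

Definition tauB (b : C) : 'M[C]_(2 * 2) :=
  ptrace1 (on_a2 (Bmx b) *m on_a1 (Bmx b)).

Definition Omega : 'M[C]_(2 * 2) :=
  on1 Zmx *m on2 sigma_plus + on1 sigma_plus *m on2 Zmx
  - on1 sigma_plus *m on2 sigma_plus.

End Operators.

Arguments Omega {C}.

(* Genericity in the Zariski sense: P holds off the zero locus in C^2 of some
   nonzero polynomial F; F.[q%:P].[p] evaluates the outer variable at q and the
   inner one at p. *)
Definition generically2 (C : nzRingType) (P : C -> C -> Prop) : Prop :=
  exists2 F : {poly {poly C}}, F != 0 &
    forall p q : C, F.[q%:P].[p] != 0 -> P p q.

(* Main.v *)
(** Tracing out the auxiliary copy gives the explicit 4 x 4 matrix [tauB_expl];
    the commutator is then a polynomial identity in each entry.  Its scalar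
    factor [4 p q (p - q)] is a nonzero polynomial and [Omega] a nonzero matrix,
    whence the generic noncommutativity. *)
Require Import Defs.
From mathcomp Require Import all_boot all_order all_algebra.
From mathcomp Require Import reals complex.
From mathcomp Require Import ring.
Import GRing.Theory.
Local Open Scope ring_scope.
Local Open Scope complex_scope.

Lemma sum_mxtens_index (V : nmodType) m n (F : 'I_(m * n) -> V) :
  \sum_x F x = \sum_i \sum_j F (mxtens_index (i, j)).
Proof.
rewrite pair_bigA (reindex (@mxtens_index m n)) /=; first by apply: eq_bigr; case.
by exists (@mxtens_unindex _ _) => ? _; rewrite ?mxtens_indexK ?mxtens_unindexK.
Qed.

Section ExplicitMatrices.
Variable C : comNzRingType.

(** [B_{a2}] cannot change site 1 and [B_{a1}] cannot change site 2, so only the auxiliary states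
    remain to be summed. *)
Lemma tauB_index (b : C) (i1 i2 j1 j2 : 'I_2) :
  tauB b (mxtens_index (i1, i2)) (mxtens_index (j1, j2)) =
  \sum_a \sum_c Bmx b (mxtens_index (a, i2)) (mxtens_index (c, j2))
                * Bmx b (mxtens_index (c, i1)) (mxtens_index (a, j1)).
Proof.
rewrite mxE; apply: eq_bigr => a _; rewrite mxE.
rewrite sum_mxtens_index; apply: eq_bigr => c _.
(* Between the two factors site 1 still carries the row label [i1], and site 2 already carries the
   column label [j2]; the Kronecker deltas kill every other intermediate state. *)
rewrite (bigD1 (mxtens_index (i1, j2))) //= big1 ?addr0; last first.
  move=> z; case: (mxtens_indexP z) => z1 z2 neq_z.
  rewrite !mxE /aux /phys1 /phys2 !mxtens_indexK /=.
  case: eqVneq => [e1|_]; last by rewrite mulr0 mul0r.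
  case: eqVneq => [e2|_]; last by rewrite !mulr0.
  by rewrite e1 e2 eqxx in neq_z.
by rewrite !mxE /aux /phys1 /phys2 !mxtens_indexK /= !eqxx !mulr1.
Qed.

Definition tauB_expl (b : C) : 'M[C]_(2 * 2) :=
  mx_of_rows (2 * 2) (2 * 2)
    [:: [:: 1 + b ^+ 2; b ^+ 2 + 2 * b; b ^+ 2 + 2 * b; 3 * b ^+ 2 + 2 * b];
        [:: 0;          2 * b;          (1 + b) ^+ 2;   b ^+ 2];
        [:: 0;          (1 + b) ^+ 2;   2 * b;          b ^+ 2];
        [:: 0;          0;              0;              1 + b ^+ 2]].

Lemma tauBE (b : C) : tauB b = tauB_expl b.
Proof.
apply/matrixP => i j.
case: (mxtens_indexP i) => i1 i2; case: (mxtens_indexP j) => j1 j2.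
rewrite tauB_index !big_ord_recl !big_ord0 !mxE /=.
case: i1 => [[|[|//]] ?]; case: i2 => [[|[|//]] ?];
  case: j1 => [[|[|//]] ?]; case: j2 => [[|[|//]] ?] /=; ring.
Qed.

Lemma OmegaE : Omega = mx_of_rows (2 * 2) (2 * 2)
    [:: [:: 0; 1; 1; -1];
        [:: 0; 0; 0; -1];
        [:: 0; 0; 0; -1];
        [:: 0; 0; 0; 0]] :> 'M[C]_(2 * 2).
Proof.
(* The mixed-product rule merges each summand into one tensor product, such as
   [Zmx *t sigma_plus]. *)
rewrite /Omega /on1 /on2 !tensmx_mul !mul1mx !mulmx1.
apply/matrixP => i j.
case: (mxtens_indexP i) => i1 i2; case: (mxtens_indexP j) => j1 j2.
rewrite !mxE !mxtens_indexK /=.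
case: i1 => [[|[|//]] ?]; case: i2 => [[|[|//]] ?];
  case: j1 => [[|[|//]] ?]; case: j2 => [[|[|//]] ?] /=; ring.
Qed.

Lemma Omega_neq0 : Omega != 0 :> 'M[C]_(2 * 2).
Proof.
(* The entry in row |00>, column |01> is 1. *)
apply/eqP => /matrixP /(_ (@Ordinal 4 0 isT) (@Ordinal 4 1 isT)).
by rewrite OmegaE !mxE /= => /eqP; rewrite oner_eq0.
Qed.

Lemma commutator_tauB (p q : C) :
  commutator (tauB p) (tauB q) = (4%:R * p * q * (p - q)) *: Omega.
Proof.
rewrite OmegaE !tauBE; apply/matrixP => i j.
rewrite !mxE !big_ord_recl !big_ord0 !mxE /=.
case: i => [[|[|[|[|//]]]] ?]; case: j => [[|[|[|[|//]]]] ?] /=; ring.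
Qed.

End ExplicitMatrices.

(** Characteristic 2 is excluded because the factor 4 would make the commutator vanish
    identically. *)
Lemma tauB_generically_noncommuting (F : fieldType) :
  2%:R != 0 :> F ->
  generically2 (fun p q : F => tauB p *m tauB q <> tauB q *m tauB p).
Proof.
(* This is p q (p - q): the inner variable [('X)%:P] stands for p, the outer ['X] for q. *)
move=> two_neq0; exists (('X)%:P * 'X * (('X)%:P - 'X)).
  apply: mulf_neq0; first by rewrite mulf_neq0 ?polyC_eq0 ?polyX_eq0.
  (* Up to sign, p - q is monic of degree 1 in the outer variable. *)
  by rewrite -oppr_eq0 opprB polyXsubC_eq0.
move=> p q; rewrite !hornerE => nz comm_pq.
have := commutator_tauB _ p q; rewrite /commutator comm_pq subrr => /esym/eqP.
(* The scalar must vanish; reassociating separates 4 from p q (p - q), and 4 = 2 * 2 is nonzero. *)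
rewrite scalemx_eq0 (negPf (Omega_neq0 _)) orbF -2!mulrA mulf_eq0 mulrA.
by rewrite (negPf nz) orbF (natrM _ 2 2) mulf_eq0 orbb (negPf two_neq0).
Qed.

Theorem mainTheorem6 (R : realType) :
  (forall p q : R[i],
     commutator (tauB p) (tauB q) = (4%:R * p * q * (p - q)) *: Omega) /\
  generically2 (fun p q : R[i] => tauB p *m tauB q <> tauB q *m tauB p).
Proof.
split; first exact: commutator_tauB.
by apply: tauB_generically_noncommuting; rewrite Num.Theory.pnatr_eq0.
Qed.
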